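(* Let $D$ be a bounded convex open subset of $\mathbb R^N$. If a sequence $(x_n)$ in $D$ converges to a horofunction of the Hilbert geometry on $D$, then $(x_n)$ converges in the usual (Euclidean) sense to a point of the Euclidean boundary $\partial D$.
   Context: Hilbert distance on $D$: for distinct $x,y\in D$, let $w,z\in\partial D$ be such that $w,x,y,z$ are collinear in this order; then $d_H(x,y):=\log\frac{|zx|\,|wy|}{|zy|\,|wx|}$, and $d_H(x,x)=0$. Fix a basepoint $b\in D$. A sequence $(x_n)$ in $D$ converges to $g:D\to\mathbb R$ if $d_H(\cdot,x_n)-d_H(b,x_n)\to g$ pointwise on $D$; a horofunction is a function $g$ obtained as such a limit of some sequence which is not of the form $d_H(\cdot,p)-d_H(b,p)$ with $p\in D$. *)

(* Defs.v *)
From HB Require Import structures.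
From mathcomp Require Import all_boot all_order all_algebra.
From mathcomp Require Import all_classical all_reals all_analysis.
Set Implicit Arguments. Unset Strict Implicit. Unset Printing Implicit Defensive.
Import Order.TTheory GRing.Theory Num.Theory.
Import numFieldNormedType.Exports.
Local Open Scope classical_set_scope.
Local Open Scope ring_scope.

Section Hilbert.
Variables (R : realType) (N : nat).
Local Notation V := 'rV[R]_N.

Definition edist (x y : V) : R := Num.sqrt (\sum_(i < N) (x ord0 i - y ord0 i) ^+ 2).

Definition convex_subset (D : set V) : Prop :=
  forall x y (t : R), D x -> D y -> 0 <= t -> t <= 1 -> D ((1 - t) *: x + t *: y).

Definition eboundary (D : set V) : set V := closure D `\` D.

Definition hilbert_endpoints (D : set V) (x y w z : V) : Prop :=
  eboundary D w /\ eboundary D z /\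
  exists t1 t2 : R, [/\ 0 < t1, t1 < t2, t2 < 1,
     x = w + t1 *: (z - w) & y = w + t2 *: (z - w)].

(** Hilbert distance on D (the endpoints are unique for D bounded convex open). *)
Definition hilbert_dist (D : set V) (x y : V) : R :=
  if x == y then 0 else
  let wz := xget (0, 0) [set p : V * V | hilbert_endpoints D x y p.1 p.2] in
  ln ((edist wz.2 x * edist wz.1 y) / (edist wz.2 y * edist wz.1 x)).

Definition hconverges (D : set V) (b : V) (x : nat -> V) (g : V -> R) : Prop :=
  forall p, D p ->
    (fun n => hilbert_dist D p (x n) - hilbert_dist D b (x n)) @ \oo --> g p.

Definition horofunction (D : set V) (b : V) (g : V -> R) : Prop :=
  (exists x : nat -> V, (forall n, D (x n)) /\ hconverges D b x g) /\
  ~ (exists p, D p /\ forall q, D q -> g q = hilbert_dist D q p - hilbert_dist D b p).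

End Hilbert.

(* Main.v *)
(** Write the Hilbert distance as [d p y = ln (M p y * M y p)], where [M] is the
exponential of the Funk distance, i.e. [M p y = |pz| / |yz|] with [z] the exit
point of the ray from [p] through [y]; [M xi p] still makes sense for [xi] on the
boundary. If [y -> xi] in the boundary then [M y p -> M xi p] and
[M p y -> +oo], while moving [p] to [q = p + h (eta - xi)], with [eta] in the
closure of [D], can only increase [M p y] asymptotically. Hence, along any
subsequence tending to [xi], [M xi p < M xi q] forces [g p < g q]. If
subsequences tended to distinct boundary points [xi] and [eta], then taking [p]
and [q] slightly off the chord [xi eta], at its two thirds, would give
[M xi p < M xi q] and [M eta q < M eta p], hence [g p < g q < g p]. A limit
point inside [D] is impossible because [g] would be [d _ xi - d b xi]. *)
Require Import Defs.
From HB Require Import structures.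
From mathcomp Require Import all_boot all_order all_algebra.
From mathcomp Require Import all_classical all_reals all_analysis.
From mathcomp Require Import ring lra.
Import Order.TTheory GRing.Theory Num.Theory.
Import numFieldNormedType.Exports.
Local Open Scope classical_set_scope.
Local Open Scope ring_scope.

Set Implicit Arguments.
Unset Strict Implicit.
Unset Printing Implicit Defensive.

(** * Compactness in terms of filters *)

(** Take an ultrafilter finer than [F]: its image contains [A], and a cluster point of an
    ultrafilter is a limit. Finer filters play the role of subsequences. *)
Lemma compact_finer_cvg (T : Type) (U : topologicalType) (F : set_system T)
    (f : T -> U) (A : set U) : ProperFilter F -> compact A -> (forall t, A (f t)) ->
  exists G, [/\ ProperFilter G, F `<=` G & exists2 u, A u & f @ G --> u].
Proof.
move=> PF cptA fA; have [G [UG FG]] := ultraFilterLemma PF.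
exists G; split => //; first exact: ultra_proper.
have fGA : G (f @^-1` A) by apply: filterE => t; apply: fA.
have [u [Au clu]] := cptA (f @ G) _ fGA.
exists u => // B Bu; have [//|nB] := in_ultra_setVsetC (f @^-1` B) UG.
by have [v []] := clu (~` B) B nB Bu.
Qed.

Section Funk.
Context {R : realType} {N : nat}.
Local Notation V := 'rV[R]_N.
Implicit Types (D : set V) (p q y z w b xi eta : V).

(** * Openness, closure and convex combinations *)

Lemma open_translate D y : open D -> D y ->
  exists2 r : R, 0 < r & forall v : V, `|v| < r -> D (y + v).
Proof.
move=> oD Dy; have /nbhs_ballP[r /= r0 rD] : nbhs y D by apply: open_nbhs_nbhs.
exists r => // v vr; apply: rD.
by rewrite -ball_normE /= opprD addNKr normrN.
Qed.

Lemma closure_translate D c : closure D c ->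
  forall r : R, 0 < r -> exists2 v : V, `|v| < r & D (c + v).
Proof.
move=> cD r r0; have [z [Dz]] := cD _ (nbhsx_ballx c r r0).
rewrite -ball_normE /= => zr; exists (z - c); first by rewrite distrC.
by rewrite addrC subrK.
Qed.

(** Replace [c] by a nearby point [c + v] of [D] and compensate by moving [z] by [- (s / t) *: v],
    which openness permits. *)
Lemma cone_closure D c z (s t : R) : convex_subset D -> open D ->
  closure D c -> D z -> 0 <= s -> 0 < t ->
  exists2 u, D u & s *: c + t *: z = (s + t) *: u.
Proof.
move=> cvD oD cD Dz; rewrite le_eqVlt => /predU1P[<-|s0] t0.
  by exists z; rewrite // scale0r !add0r.
have [r r0 rD] := open_translate oD Dz.
have [|v vr Dv] := closure_translate cD (r := r * t / s).
  by rewrite divr_gt0 ?mulr_gt0.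
have Dz' : D (z - (s / t) *: v).
  apply: rD; rewrite normrN normrZ gtr0_norm ?divr_gt0//.
  by rewrite mulrC -ltr_pdivlMr ?divr_gt0// invf_div mulrA.
have st0 : s + t != 0 by rewrite gt_eqF ?addr_gt0.
have k01 : 0 <= t / (s + t) /\ t / (s + t) <= 1.
  split; first by rewrite divr_ge0 ?addr_ge0 ?ltW.
  by rewrite ler_pdivrMr ?addr_gt0// mul1r lerDr ltW.
exists ((1 - t / (s + t)) *: (c + v) + (t / (s + t)) *: (z - (s / t) *: v)).
  exact: cvD _ _ _ Dv Dz' k01.1 k01.2.
apply/rowP => i; rewrite !mxE; field.
by rewrite st0 gt_eqF.
Qed.

Lemma cone_add D y z (s t : R) : convex_subset D -> open D ->
  D y -> D z -> 0 <= s -> 0 < t ->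
  exists2 u, D u & s *: y + t *: z = (s + t) *: u.
Proof. by move=> cvD oD Dy; apply: cone_closure => //; apply: subset_closure. Qed.

(** * The Funk ratio as an infimum *)

(** For [p != y] in [D], [funk_dist] is the ratio [|pz| / |yz|], where [z] is the
point at which the ray from [p] through [y] leaves [D]: the points
[(l *: y - p) / (l - 1)] describe this ray beyond [y], from [z] at the ratio to
[y] at [l = +oo]. *)
Definition funk_bound D p y (l : R) : Prop :=
  1 < l /\ exists2 z, D z & l *: y = p + (l - 1) *: z.

Definition funk_dist D p y : R := inf (funk_bound D p y).

(** The point serving for [m] is a convex combination of [y] and the point serving for [l]. *)
Lemma funk_bound_mono D p y (l m : R) : convex_subset D -> open D -> D y ->
  funk_bound D p y l -> l <= m -> funk_bound D p y m.
Proof.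
move=> cvD oD Dy [l1 [z Dz lE]] lm; split; first exact: lt_le_trans lm.
have [||u Du uE] := @cone_add D y z (m - l) (l - 1) cvD oD Dy Dz.
- by rewrite subr_ge0.
- by rewrite subr_gt0.
exists u => //; have -> : m - 1 = m - l + (l - 1) by ring.
rewrite -uE addrCA -lE -scalerDl; congr (_ *: _); ring.
Qed.

(** The identity (l + e) y = p' + (l - 1) z + e (y + (p - p') / e) absorbs the displacement of [p]
    into a point of [D] near [y]. The case [l = 1], where [p = y], serves [funk_bound_near]. *)
Lemma funk_bound_perturb D p p' y z (l e r : R) : convex_subset D -> open D ->
  (forall v : V, `|v| < r -> D (y + v)) -> D z -> 1 <= l ->
  l *: y = p + (l - 1) *: z -> 0 < e -> `|p - p'| < e * r ->
  funk_bound D p' y (l + e).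
Proof.
move=> cvD oD rD Dz l1 lE e0 pr; split; first by lra.
have Dy' : D (y + e^-1 *: (p - p')).
  by apply: rD; rewrite normrZ gtr0_norm ?invr_gt0// ltr_pdivrMl.
have [|u Du uE] := @cone_add D z _ (l - 1) e cvD oD Dz Dy' _ e0.
  by rewrite subr_ge0.
exists u => //; have -> : l + e - 1 = l - 1 + e by ring.
rewrite -uE scalerDr scalerA divff ?gt_eqF// scale1r scalerDl lE.
by apply/rowP => i; rewrite !mxE; ring.
Qed.

Lemma funk_bound_near D p y (l r : R) : convex_subset D -> open D ->
  D y -> (forall v : V, `|v| < r -> D (y + v)) -> 1 < l -> `|y - p| < (l - 1) * r ->
  funk_bound D p y l.
Proof.
move=> cvD oD Dy rD l1 ypr; have -> : l = 1 + (l - 1) by ring.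
apply: (@funk_bound_perturb D y p y y 1 (l - 1) r) => //; last by rewrite subr_gt0.
by rewrite subrr scale0r scale1r addr0.
Qed.

Lemma funk_bound_nonempty D p y : convex_subset D -> open D -> D y ->
  exists l, funk_bound D p y l.
Proof.
move=> cvD oD Dy; have [r r0 rD] := open_translate oD Dy.
exists (1 + (`|y - p| / r + 1)); apply: (funk_bound_near _ _ Dy rD) => //.
  by rewrite ltrDl ltr_wpDl// divr_ge0// ltW.
by rewrite addrAC subrr add0r mulrDl divfK ?gt_eqF// mul1r ltrDl.
Qed.

Lemma funk_dist_has_inf D p y : convex_subset D -> open D -> D y ->
  has_inf (funk_bound D p y).
Proof.
move=> cvD oD Dy; split; first exact: funk_bound_nonempty.
by exists 1 => l [/ltW].
Qed.

Lemma funk_dist_le D p y (l : R) : funk_bound D p y l -> funk_dist D p y <= l.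
Proof. by move=> pyl; apply: ge_inf => //; exists 1 => m [/ltW]. Qed.

Lemma funk_dist_ge D p y (m : R) : convex_subset D -> open D -> D y ->
  (forall l, funk_bound D p y l -> m <= l) -> m <= funk_dist D p y.
Proof.
by move=> cvD oD Dy h; apply: lb_le_inf => //; apply: funk_bound_nonempty.
Qed.

Lemma funk_dist_ge1 D p y : convex_subset D -> open D -> D y -> 1 <= funk_dist D p y.
Proof. by move=> cvD oD Dy; apply: funk_dist_ge => // l [/ltW]. Qed.

Lemma funk_dist_gt0 D p y : convex_subset D -> open D -> D y -> 0 < funk_dist D p y.
Proof. by move=> cvD oD Dy; apply: lt_le_trans (funk_dist_ge1 _ _ _ _). Qed.

Lemma funk_dist_lt D p y (l : R) : convex_subset D -> open D -> D y ->
  funk_dist D p y < l -> funk_bound D p y l.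
Proof.
move=> cvD oD Dy pyl.
have l0 : 0 < l - funk_dist D p y by rewrite subr_gt0.
have [m bm] := inf_adherent l0 (funk_dist_has_inf p cvD oD Dy).
by rewrite -/(funk_dist D p y) addrC subrK => /ltW; apply: funk_bound_mono.
Qed.

Lemma funk_dist_refl D y : convex_subset D -> open D -> D y -> funk_dist D y y = 1.
Proof.
move=> cvD oD Dy; apply/le_anti; rewrite funk_dist_ge1// andbT.
apply/ler_addgt0Pr => e e0; apply: funk_dist_le; split; first by rewrite ltrDl.
by exists y => //; rewrite addrAC subrr add0r scalerDl scale1r.
Qed.

(** Bounds multiply: substituting m y = q + (m - 1) w into l q = p + (l - 1) z gives l m y = p + (l
    - 1) z + l (m - 1) w. *)
Lemma funk_dist_triangle D p q y : convex_subset D -> open D -> D q -> D y ->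
  funk_dist D p y <= funk_dist D p q * funk_dist D q y.
Proof.
move=> cvD oD Dq Dy.
rewrite -ler_pdivrMr ?funk_dist_gt0//; apply: funk_dist_ge => // l bl.
rewrite ler_pdivrMr ?funk_dist_gt0// mulrC -ler_pdivrMr; last first.
  exact: lt_trans ltr01 bl.1.
apply: funk_dist_ge => // m bm; rewrite ler_pdivrMr; last first.
  exact: lt_trans ltr01 bl.1.
apply: funk_dist_le; move: bl bm => [l1 [z Dz lE]] [m1 [w Dw mE]].
split; first by nra.
have [||u Du uE] := @cone_add D z w (l - 1) (l * (m - 1)) cvD oD Dz Dw.
- by rewrite subr_ge0 ltW.
- by rewrite mulr_gt0 ?subr_gt0// (lt_trans ltr01).
exists u => //; have -> : m * l - 1 = l - 1 + l * (m - 1) by ring.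
by rewrite mulrC -uE addrA -lE -!scalerA -scalerDr -mE.
Qed.

(** * Moving the first argument *)

Lemma funk_dist_lipschitz D p p' y (e r : R) : convex_subset D -> open D -> D y ->
  (forall v : V, `|v| < r -> D (y + v)) -> 0 < e -> `|p - p'| < e * r ->
  funk_dist D p' y <= funk_dist D p y + e.
Proof.
move=> cvD oD Dy rD e0 pr; rewrite -lerBlDr; apply: funk_dist_ge => // l [l1 [z Dz lE]].
rewrite lerBlDr; apply: funk_dist_le.
by apply: (funk_bound_perturb _ _ rD Dz _ lE) => //; exact: ltW.
Qed.

(* [M p y] is the supremum of [phi p / phi y] over the affine functions [phi >= 0]
on [D], and [phi (p + h (eta - y)) >= phi p - h * phi y]; the factor [1 + e] pays
for replacing [p + h (eta - y)] by the nearby point [p']. *)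
Lemma funk_dist_translate D p p' y eta (h e r : R) : convex_subset D -> open D ->
  D y -> closure D eta -> (forall v : V, `|v| < r -> D (p' + v)) -> D p' ->
  0 < e -> 0 <= h -> `|p' - p - h *: (eta - y)| < e * r ->
  funk_dist D p y <= (1 + e) * funk_dist D p' y + h.
Proof.
move=> cvD oD Dy cleta rD Dp' e0 h0 hr.
have e10 : 0 < 1 + e by rewrite addr_gt0.
rewrite -lerBlDr mulrC -ler_pdivrMr//; apply: funk_dist_ge => // l [l1 [z Dz lE]].
rewrite ler_pdivrMr// lerBlDr; apply: funk_dist_le; split; first by nra.
have Dp'' : D (p' + e^-1 *: (p' - p - h *: (eta - y))).
  by apply: rD; rewrite normrZ gtr0_norm ?invr_gt0// ltr_pdivrMl.
have l10 : 0 < (1 + e) * (l - 1) by rewrite mulr_gt0// subr_gt0.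
have [u Du uE] := cone_add cvD oD Dp'' Dz (ltW e0) l10.
have [|w Dw wE] := cone_closure cvD oD cleta Du h0 (_ : 0 < e + (1 + e) * (l - 1)).
  by rewrite addr_gt0.
exists w => //; have -> : l * (1 + e) + h - 1 = h + (e + (1 + e) * (l - 1)) by ring.
rewrite -wE -uE scalerDr scalerA divff ?gt_eqF// scale1r.
apply/rowP => i; have := congr1 (fun v : V => (1 + e) * v ord0 i) lE.
by rewrite !mxE => h1; lra.
Qed.

(** * Exit points on the boundary *)

Lemma closure_bounded D : bounded_set D ->
  exists2 C : R, 0 < C & forall z, closure D z -> `|z| <= C.
Proof.
move=> /pinfty_ex_gt0[M M0 MD]; exists (M + 1); first by rewrite addr_gt0.
move=> z /closure_translate/(_ 1 ltr01)[v v1 /MD zvM].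
rewrite -(addrK v z); apply: le_trans (ler_normB _ _) _.
by rewrite lerD// ltW.
Qed.

(** Since y - p = (l - 1) (z - y) and |z - y| <= 2 C, every [l - 1] is at least |y - p| / (2 C). *)
Lemma funk_dist_gt1 D p y : bounded_set D -> convex_subset D -> open D -> D y ->
  p != y -> 1 < funk_dist D p y.
Proof.
move=> /closure_bounded[C C0 CD] cvD oD Dy py.
have yp0 : 0 < `|y - p| by rewrite normr_gt0 subr_eq0 eq_sym.
have CC0 : 0 < C + C by rewrite addr_gt0.
apply: (@lt_le_trans _ _ (1 + `|y - p| / (C + C))).
  by rewrite ltrDl divr_gt0.
apply: funk_dist_ge => // l [l1 [z Dz lE]].
rewrite -lerBrDl ler_pdivrMr//.
have -> : y - p = (l - 1) *: (z - y).
  apply/rowP => i; have := congr1 (fun v : V => v ord0 i) lE.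
  by rewrite !mxE => h; lra.
rewrite normrZ gtr0_norm ?subr_gt0// ler_pM2l ?subr_gt0//.
by apply: le_trans (ler_normB _ _) _; rewrite lerD// CD//; apply: subset_closure.
Qed.

(** Every [l + e] is a bound because [z] is in the closure; a bound [m < l] would make [z] a convex
    combination of [y] and a point of [D]. *)
Lemma funk_dist_boundary D p y z (l : R) : convex_subset D -> open D -> D y ->
  eboundary D z -> 1 < l -> l *: y = p + (l - 1) *: z -> funk_dist D p y = l.
Proof.
move=> cvD oD Dy [clz nDz] l1 lE; apply/le_anti/andP; split.
  apply/ler_addgt0Pr => e e0; apply: funk_dist_le; split; first by lra.
  have [|u Du uE] := cone_closure cvD oD clz Dy (_ : 0 <= l - 1) e0.
    by rewrite subr_ge0 ltW.
  exists u => //; rewrite addrAC -uE scalerDl lE addrA.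
  by apply/rowP => i; rewrite !mxE; ring.
apply: funk_dist_ge => // m [m1 [z' Dz' mE]]; rewrite leNgt; apply/negP => ml.
apply: nDz.
have [||u Du uE] := @cone_add D y z' (l - m) (m - 1) cvD oD Dy Dz'.
- by rewrite subr_ge0 ltW.
- by rewrite subr_gt0.
suff -> : z = u by [].
have l10 : l - 1 != 0 by rewrite subr_eq0 gt_eqF.
apply: (scalerI l10); have -> : (l - 1) *: u = (l - m + (m - 1)) *: u.
  by congr (_ *: _); ring.
rewrite -uE; apply/rowP => i; have := congr1 (fun v : V => v ord0 i) lE.
have := congr1 (fun v : V => v ord0 i) mE.
by rewrite !mxE => h h'; lra.
Qed.

Lemma funk_dist_exit D p y : bounded_set D -> convex_subset D -> open D -> D y ->
  p != y -> exists2 z, eboundary D z &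
    funk_dist D p y *: y = p + (funk_dist D p y - 1) *: z.
Proof.
move=> bD cvD oD Dy py; have l1 := funk_dist_gt1 bD cvD oD Dy py.
have [C C0 CD] := closure_bounded bD.
set l := funk_dist D p y in l1 *.
have l10 : 0 < l - 1 by rewrite subr_gt0.
have l1n0 : l - 1 != 0 by rewrite gt_eqF.
pose z := (l - 1)^-1 *: (l *: y - p).
have zE : l *: y = p + (l - 1) *: z.
  by rewrite scalerA divff// scale1r addrC subrK.
exists z => //; split.
  move=> A /nbhs_ballP[e /= e0 eA].
  have CC0 : 0 < C + C + 1 by rewrite !addr_gt0.
  (* The bound [l + d] yields [u] in [D] with z - u = (d / (l - 1)) (u - y), and |u - y| <= 2 C;
     this [d] makes the gap smaller than [e]. *)
  pose d := e * (l - 1) / (C + C + 1).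
  have d0 : 0 < d by rewrite divr_gt0// mulr_gt0.
  have [ld1 [u Du uE]] : funk_bound D p y (l + d).
    by apply: funk_dist_lt => //; rewrite ltrDl.
  exists u; split => //; apply: eA; rewrite -ball_normE /=.
  have -> : z - u = (d / (l - 1)) *: (u - y).
    apply: (scalerI l1n0); rewrite scalerA mulrC divfK//.
    apply/rowP => i; have := congr1 (fun v : V => v ord0 i) uE.
    have := congr1 (fun v : V => v ord0 i) zE.
    by rewrite !mxE => h h'; lra.
  rewrite normrZ gtr0_norm; last exact: divr_gt0.
  have -> : d / (l - 1) = e / (C + C + 1).
    by rewrite /d; field; rewrite l1n0 gt_eqF.
  rewrite -mulrA gtr_pMr// ltr_pdivrMl// mulr1.
  apply: le_lt_trans (ler_normB _ _) _; rewrite ltr_pwDr// lerD// CD//;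
    exact: subset_closure.
move=> Dz; have [r r0 rD] := open_translate oD Dz.
set a := `|z - y|.
have a0 : 0 <= a by exact: normr_ge0.
have ra0 : 0 < r + a + 1 by lra.
(* If [z] were in [D], the ray would continue past it and [l - d] would be a bound. This [d] gives d
   / (l - d - 1) = r / (a + 1), so the point used stays within [r] of [z]. *)
pose d := (l - 1) * r / (r + a + 1).
have d0 : 0 < d by rewrite divr_gt0// mulr_gt0.
have ld : l - d - 1 = (l - 1) * (a + 1) / (r + a + 1).
  by rewrite /d; field; rewrite gt_eqF.
have ld0 : 0 < l - d - 1 by rewrite ld divr_gt0// mulr_gt0// ltr_wpDl.
suff /funk_dist_le : funk_bound D p y (l - d).
  by rewrite -/l; apply/negP; rewrite -ltNge ltrBlDr ltrDl.
split; first by rewrite -subr_gt0.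
exists (z + (d / (l - d - 1)) *: (z - y)).
  apply: rD; rewrite normrZ gtr0_norm -/a; last exact: divr_gt0.
  have -> : d / (l - d - 1) = r / (a + 1).
    rewrite ld /d; field; rewrite l1n0 !gt_eqF// ltr_wpDl//.
  by rewrite -mulrA gtr_pMr// ltr_pdivrMl ?ltr_wpDl// mulr1 ltrDl.
rewrite scalerDr scalerA [_ * (d / _)]mulrC divfK ?gt_eqF// scalerBl zE.
by apply/rowP => i; rewrite !mxE; ring.
Qed.

(** * Behaviour at the boundary *)

(** A value at most [K] for [y] close to [xi] would write (K + 1) xi as K z + p', with p' = p + (K +
    1) (xi - y) still in [D], forcing [xi] into [D]. *)
Lemma funk_dist_diverges D p xi (K : R) : open D -> convex_subset D -> D p ->
  ~ D xi -> 0 < K ->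
  exists2 d : R, 0 < d & forall y, D y -> `|y - xi| < d -> K < funk_dist D p y.
Proof.
move=> oD cvD Dp nDxi K0; have [r r0 rD] := open_translate oD Dp.
have K10 : 0 < K + 1 by rewrite addr_gt0.
exists (r / (K + 1)); first by rewrite divr_gt0.
move=> y Dy yxi; rewrite ltNge; apply/negP => yK; apply: nDxi.
have [_ [z Dz zE]] : funk_bound D p y (K + 1).
  by apply: funk_dist_lt => //; rewrite (le_lt_trans yK)// ltrDl.
have Dp' : D (p + (K + 1) *: (xi - y)).
  apply: rD; rewrite normrZ gtr0_norm// distrC.
  by rewrite mulrC -ltr_pdivlMr.
have [||u Du uE] := @cone_add D z _ K 1 cvD oD Dz Dp'.
- exact: ltW.
- exact: ltr01.
suff -> : xi = u by [].
have K1n0 : K + 1 != 0 by rewrite gt_eqF.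
apply: (scalerI K1n0); rewrite -uE.
apply/rowP => i; have := congr1 (fun v : V => v ord0 i) zE.
by rewrite !mxE => h; lra.
Qed.

(* With [z] the exit point of the ray from [xi] through [q], the triangle
[xi, b, z] lies in the closure of [D], and the ray from [xi] through [p] leaves it
proportionally farther beyond [p] than [z] is beyond [q]. *)
Lemma funk_dist_steeper D xi b p q (th s : R) : bounded_set D ->
  convex_subset D -> open D -> D b -> D p -> D q -> xi != q ->
  0 < th -> th < 1 -> 0 < s ->
  s * funk_dist D xi q < funk_dist D xi q - 1 ->
  p = xi + th *: (q - xi) + ((1 - th) * s) *: (b - xi) ->
  funk_dist D xi p < funk_dist D xi q.
Proof.
move=> bD cvD oD Db Dp Dq xiq th0 th1 s0 sl pE.
have l1 := funk_dist_gt1 bD cvD oD Dq xiq.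
have [z [clz _] zE] := funk_dist_exit bD cvD oD Dq xiq.
set l := funk_dist D xi q in l1 sl zE *.
have l0 : 0 < l by rewrite (lt_trans ltr01).
have s1 : s < 1 by nra.
(* The weight of [xi] when [p] is written as a convex combination of [xi], [z] and [b]. The
   hypothesis [sl] means (1 - s) l > 1, which is what puts [k] above 1 / l. *)
pose k := th / l + (1 - s) * (1 - th).
have k0 : 0 < k by rewrite addr_gt0 ?divr_gt0// mulr_gt0// subr_gt0.
have kl : l^-1 < k.
  rewrite -(ltr_pM2r l0) mulVf ?gt_eqF// /k mulrDl divfK ?gt_eqF//; nra.
apply: (@le_lt_trans _ _ k^-1); last by rewrite invf_plt ?posrE.
have k1 : k < 1.
  rewrite /k; have : th / l < th by rewrite ltr_pdivrMr// ltr_pMr.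
  nra.
apply: funk_dist_le; split; first by rewrite invf_pgt ?posrE// invr1.
have ln0 : l != 0 by rewrite gt_eqF.
have kn0 : k != 0 by rewrite gt_eqF.
have [||u Du uE] := @cone_closure D z b (k^-1 * (th * (l - 1) / l))
  (k^-1 * ((1 - th) * s)) cvD oD clz Db.
- by rewrite mulr_ge0 ?invr_ge0 ?ltW// divr_gt0 ?mulr_gt0// subr_gt0.
- by rewrite mulr_gt0 ?invr_gt0// mulr_gt0// subr_gt0.
exists u => //; have -> : k^-1 - 1 = k^-1 * (th * (l - 1) / l) + k^-1 * ((1 - th) * s).
  apply: (mulfI kn0); rewrite mulrBr mulrDr !mulrA divff// mul1r mulr1 mul1r /k.
  by field.
rewrite -uE pE; apply/rowP => i; rewrite !mxE.
have := congr1 (fun v : V => l^-1 * v ord0 i) zE.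
rewrite !mxE mulKf// => ->.
apply: (mulfI kn0); rewrite !mulrDr !mulrA divff// !mul1r /k.
by field.
Qed.

(** Supplies the slope hypothesis of [funk_dist_steeper] uniformly in [z] and [l]. The right side
    has norm at most (l - 1) 2 C, while [s0] is chosen so that the vector scaled by [l] on the left
    is longer than 2 s C. *)
Lemma small_step D xi b (e : V) : bounded_set D -> closure D xi -> D b -> e != 0 ->
  exists2 s0 : R, 0 < s0 & forall (s l : R) z, 0 < s -> s < s0 -> 1 < l -> closure D z ->
    l *: (s *: (b - xi) + (1 - s) *: e) = (l - 1) *: (z - xi) -> s * l < l - 1.
Proof.
move=> /closure_bounded[C C0 CD] clxi Db; rewrite -normr_gt0 => e0.
have b0 : 0 < 2 * (C + C) + `|e| by rewrite !addr_gt0// mulr_gt0// addr_gt0.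
exists (`|e| / (2 * (C + C) + `|e|)); first by rewrite divr_gt0.
move=> s l z s0; rewrite ltr_pdivlMr// => sb l1 clz lE.
have l0 : 0 < l by rewrite (lt_trans ltr01).
have s1 : s < 1 by nra.
have zxi : `|z - xi| <= C + C.
  by apply: le_trans (ler_normB _ _) _; rewrite lerD// CD.
have bxi : `|b - xi| <= C + C.
  by apply: le_trans (ler_normB _ _) _; rewrite lerD// CD//; apply: subset_closure.
have h1 : (1 - s) * `|e| - s * (C + C) <= `|s *: (b - xi) + (1 - s) *: e|.
  have -> : (1 - s) * `|e| = `|(1 - s) *: e| by rewrite normrZ gtr0_norm// subr_gt0.
  have : `|s *: (b - xi)| <= s * (C + C) by rewrite normrZ gtr0_norm// ler_pM2l.
  have := ler_normB (s *: (b - xi) + (1 - s) *: e) (s *: (b - xi)).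
  rewrite addrAC subrr add0r => h h'; lra.
have h2 : l * `|s *: (b - xi) + (1 - s) *: e| <= (l - 1) * (C + C).
  have := congr1 (fun v : V => `|v|) lE.
  rewrite !normrZ !gtr0_norm ?subr_gt0// => ->.
  by rewrite ler_pM2l ?subr_gt0.
have C20 : 0 < C + C by rewrite addr_gt0.
rewrite -(ltr_pM2r C20); apply: lt_le_trans h2.
rewrite mulrAC mulrC ltr_pM2l//; apply: lt_le_trans h1; lra.
Qed.

(** * The Hilbert distance through Funk ratios *)

Local Notation edist := (@Defs.edist R N).

Lemma edist_segment (w z : V) (s t : R) :
  edist (w + s *: (z - w)) (w + t *: (z - w)) = `|s - t| * edist z w.
Proof.
rewrite /Defs.edist.
under eq_bigr do rewrite !mxE.
have -> : \sum_(i < N) (w ord0 i + s * (z ord0 i - w ord0 i) -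
    (w ord0 i + t * (z ord0 i - w ord0 i))) ^+ 2 =
    (s - t) ^+ 2 * \sum_(i < N) (z ord0 i - w ord0 i) ^+ 2.
  by rewrite mulr_sumr; apply: eq_bigr => i _; ring.
by rewrite sqrtrM ?sqr_ge0// sqrtr_sqr.
Qed.

Lemma edist_eq0 (x y : V) : edist x y = 0 -> x = y.
Proof.
move=> /eqP; rewrite sqrtr_eq0 => le0.
have sum0 : \sum_(i < N) (x ord0 i - y ord0 i) ^+ 2 = 0.
  by apply/le_anti; rewrite le0 sumr_ge0// => i _; rewrite sqr_ge0.
apply/rowP => i; apply/eqP; rewrite -subr_eq0 -sqrf_eq0.
by rewrite (psumr_eq0P _ sum0)// => j _; rewrite sqr_ge0.
Qed.

Lemma hilbert_endpoints_ex D p y : bounded_set D -> convex_subset D -> open D ->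
  D p -> D y -> p != y -> exists wz, hilbert_endpoints D p y wz.1 wz.2.
Proof.
move=> bD cvD oD Dp Dy py.
have yp : y != p by rewrite eq_sym.
have := funk_dist_gt1 bD cvD oD Dy py; have := funk_dist_gt1 bD cvD oD Dp yp.
have [z bz zE] := funk_dist_exit bD cvD oD Dy py.
have [w bw wE] := funk_dist_exit bD cvD oD Dp yp.
move: (funk_dist D p y) (funk_dist D y p) zE wE => l m zE wE m1 l1.
exists (w, z); split=> //; split=> //=.
have lm1 : 0 < l * m - 1 by rewrite subr_gt0; nra.
have lmn0 : l * m - 1 != 0 by rewrite gt_eqF.
(* Eliminating [y], then [p], from the two exit equations gives both points as combinations of [w]
   and [z] of total weight [l * m - 1]. *)
have pE : (l * m - 1) *: p = (l * (m - 1)) *: w + (l - 1) *: z.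
  apply/rowP => i; have := congr1 (fun v : V => v ord0 i) zE.
  have := congr1 (fun v : V => l * v ord0 i) wE.
  by rewrite !mxE => h h'; lra.
have yE : (l * m - 1) *: y = (m - 1) *: w + (m * (l - 1)) *: z.
  apply/rowP => i; have := congr1 (fun v : V => m * v ord0 i) zE.
  have := congr1 (fun v : V => v ord0 i) wE.
  by rewrite !mxE => h h'; lra.
exists ((l - 1) / (l * m - 1)), (m * (l - 1) / (l * m - 1)); split.
- by rewrite divr_gt0// subr_gt0.
- by rewrite ltr_pM2r ?invr_gt0// ltr_pMl// subr_gt0.
- by rewrite ltr_pdivrMr// mul1r; lra.
- apply: (scalerI lmn0); rewrite pE; apply/rowP => i; rewrite !mxE.
  by field.
- apply: (scalerI lmn0); rewrite yE; apply/rowP => i; rewrite !mxE.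
  by field.
Qed.

(** By [funk_dist_boundary], any endpoints determine the two Funk ratios as [(1 - t1) / (1 - t2)]
    and [t2 / t1], whose product is the cross-ratio. The choice made by [xget] is thus harmless. *)
Lemma hilbert_distE D p y : bounded_set D -> convex_subset D -> open D ->
  D p -> D y -> hilbert_dist D p y = ln (funk_dist D p y * funk_dist D y p).
Proof.
move=> bD cvD oD Dp Dy; rewrite /hilbert_dist; case: eqVneq => [->|py].
  by rewrite funk_dist_refl// mulr1 ln1.
have [wz wzE] := hilbert_endpoints_ex bD cvD oD Dp Dy py.
have := @xgetPex _ (0, 0) [set q : V * V | hilbert_endpoints D p y q.1 q.2].
move=> /(_ (ex_intro _ wz wzE)) /=.
move: (xget _ _) => [w z] /= [bw [bz [t1 [t2 [t10 t12 t21 pE yE]]]]]; congr ln.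
have t20 : 0 < t2 by exact: lt_trans t12.
have t11 : t1 < 1 by exact: lt_trans t21.
have -> : funk_dist D p y = (1 - t1) / (1 - t2).
  apply: (funk_dist_boundary cvD oD Dy bz).
    by rewrite ltr_pdivlMr ?subr_gt0// mul1r ltrD2l ltrN2.
  rewrite pE yE; apply/rowP => i; rewrite !mxE; field.
  by rewrite subr_eq0 gt_eqF.
have -> : funk_dist D y p = t2 / t1.
  apply: (funk_dist_boundary cvD oD Dp bw).
    by rewrite ltr_pdivlMr// mul1r.
  rewrite pE yE; apply/rowP => i; rewrite !mxE; field.
  by rewrite gt_eqF.
have E0 : edist z w != 0.
  apply/eqP => /edist_eq0 zw; move: py.
  by rewrite pE yE zw subrr !scaler0 eqxx.
have zt t : edist z (w + t *: (z - w)) = `|1 - t| * edist z w.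
  by rewrite -edist_segment scale1r [w + (z - w)]addrC subrK.
have wt t : edist w (w + t *: (z - w)) = `|t| * edist z w.
  by rewrite -normrN -[- t]sub0r -edist_segment scale0r addr0.
rewrite pE yE !zt !wt !gtr0_norm ?subr_gt0//.
by field; rewrite E0 gt_eqF// subr_eq0 gt_eqF.
Qed.

Lemma expR_hilbert_dist D p y : bounded_set D -> convex_subset D -> open D ->
  D p -> D y -> expR (hilbert_dist D p y) = funk_dist D p y * funk_dist D y p.
Proof.
move=> bD cvD oD Dp Dy; rewrite hilbert_distE// lnK// posrE.
by rewrite mulr_gt0// funk_dist_gt0.
Qed.

(** * Comparing two values of the limit function *)

Lemma near_norm_lt (T : Type) (F : set_system T) (FF : Filter F) (x : T -> V) xi
    (e : R) : x @ F --> xi -> 0 < e -> \forall n \near F, `|x n - xi| < e.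
Proof. by move=> /cvgr_dist_lt xxi e0; near=> n; rewrite distrC; near: n; apply: xxi.
Unshelve. all: by end_near. Qed.

(** A limit keeps only weak inequalities, so the differences are held below a fixed [ln k] with
    [k < 1]. Eventually the Funk ratio to [x n] from [p] is at most [1 + 2 * e] times that from [q],
    while the ratios from [x n] approach [A < B]. *)
Lemma horofunction_lt D b (x : nat -> V) (g : V -> R) (F : set_system nat)
    (FF : ProperFilter F) xi eta p q (h : R) :
  bounded_set D -> convex_subset D -> open D -> D b -> (forall n, D (x n)) ->
  hconverges D b x g -> F `=>` \oo -> x @ F --> xi -> ~ D xi -> closure D eta ->
  D p -> D q -> 0 <= h -> q = p + h *: (eta - xi) ->
  funk_dist D xi p < funk_dist D xi q -> g p < g q.
Proof.
move=> bD cvD oD Db Dx cvx Foo xxi nDxi cleta Dp Dq h0 qE AB.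
have [r r0 rD] := open_translate oD Dp.
have [r' r'0 r'D] := open_translate oD Dq.
have A1 := funk_dist_ge1 xi cvD oD Dp.
set A := funk_dist D xi p in AB A1; set B := funk_dist D xi q in AB.
(* Small enough that [(1 + 2 * e) * (A + e) < B - e], that is, [k < 1]. *)
pose e := (B - A) / (B - A + 2 * (5 + 3 * A)).
have d0 : 0 < B - A by rewrite subr_gt0.
have c0 : 0 < B - A + 2 * (5 + 3 * A) by lra.
have e0 : 0 < e by exact: divr_gt0.
have eE : e * (B - A + 2 * (5 + 3 * A)) = B - A by rewrite divfK// gt_eqF.
have e1 : e < 1 by rewrite ltr_pdivrMr// mul1r; lra.
have he0 : 0 < h / e + 1 by rewrite ltr_wpDl// divr_ge0// ltW.
have h10 : 0 < h + 1 by lra.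
(* Beyond this threshold the additive error [h] is at most [e] times the Funk ratio from [q]. *)
have [d dd0 dD] := funk_dist_diverges oD cvD Dq nDxi he0.
pose k := ((1 + 2 * e) * (A + e)) / (B - e).
have Be0 : 0 < B - e by lra.
have k0 : 0 < k by rewrite divr_gt0// mulr_gt0//; lra.
have k1 : k < 1 by rewrite ltr_pdivrMr// mul1r; nra.
have kE : k * (B - e) = (1 + 2 * e) * (A + e) by rewrite divfK// gt_eqF.
clearbody k.
suff : g p - g q <= ln k.
  by have := ln_lt0 (_ : 0 < k < 1); rewrite k0 k1 => /(_ isT) lk gpq; lra.
have cvg_pq : (fun n => hilbert_dist D p (x n) - hilbert_dist D q (x n)) @ F
    --> g p - g q.
  have -> : (fun n => hilbert_dist D p (x n) - hilbert_dist D q (x n)) =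
      (fun n => hilbert_dist D p (x n) - hilbert_dist D b (x n) -
                (hilbert_dist D q (x n) - hilbert_dist D b (x n))).
    by apply/funext => n; ring.
  by apply: cvgB; [apply: cvg_trans (cvx _ Dp)|apply: cvg_trans (cvx _ Dq)];
    apply: cvg_app.
apply: (cvgr_to_le cvg_pq); near=> n.
have xE : hilbert_dist D p (x n) - hilbert_dist D q (x n) =
   ln (funk_dist D p (x n) * funk_dist D (x n) p /
       (funk_dist D q (x n) * funk_dist D (x n) q)).
  by rewrite ln_div ?posrE ?mulr_gt0 ?funk_dist_gt0// -!hilbert_distE.
rewrite xE ler_ln ?posrE ?divr_gt0 ?mulr_gt0 ?funk_dist_gt0//.
have h1 : funk_dist D p (x n) <= (1 + e) * funk_dist D q (x n) + h.
  apply: (funk_dist_translate cvD oD (Dx n) cleta r'D Dq e0 h0).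
  (* The error vector reduces to [h *: (x n - xi)]; the factor [h + 1] covers [h = 0]. *)
  rewrite qE (_ : _ - _ - _ = h *: (x n - xi)); last first.
    by apply/rowP => i; rewrite !mxE; ring.
  rewrite normrZ ger0_norm//; apply: le_lt_trans (_ : (h + 1) * `|x n - xi| < _).
    by rewrite ler_wpM2r// lerDl.
  rewrite -ltr_pdivlMl//.
  near: n; apply: near_norm_lt => //.
  by rewrite !mulr_gt0// invr_gt0.
have h2 : h / e + 1 < funk_dist D q (x n).
  apply: dD => //; near: n; exact: near_norm_lt.
have h3 : funk_dist D (x n) p <= A + e.
  apply: (funk_dist_lipschitz cvD oD Dp rD e0); rewrite distrC.
  by near: n; apply: near_norm_lt => //; rewrite mulr_gt0.
have h4 : B <= funk_dist D (x n) q + e.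
  apply: (funk_dist_lipschitz cvD oD Dq r'D e0).
  by near: n; apply: near_norm_lt => //; rewrite mulr_gt0.
have h5 : h <= e * funk_dist D q (x n).
  rewrite -ler_pdivrMl// mulrC; lra.
have m0 := funk_dist_gt0 q cvD oD (Dx n).
rewrite ler_pdivrMr ?mulr_gt0 ?funk_dist_gt0//.
apply: (@le_trans _ _ ((1 + 2 * e) * funk_dist D q (x n) * (A + e))).
  by apply: ler_pM; rewrite ?(ltW (funk_dist_gt0 _ _ _ _))//; lra.
have h6 : k * funk_dist D q (x n) * (B - e) <=
    k * funk_dist D q (x n) * funk_dist D (x n) q.
  apply: ler_wpM2l; first exact: ltW (mulr_gt0 k0 m0).
  by rewrite lerBlDr.
rewrite [leRHS]mulrA; apply: le_trans h6.
by rewrite [leRHS]mulrAC kE [leLHS]mulrAC lexx.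
Unshelve. all: by end_near. Qed.

(** * Metric properties and interior limits *)

Lemma hilbert_dist_triangle D p q y : bounded_set D -> convex_subset D -> open D ->
  D p -> D q -> D y -> hilbert_dist D p y <= hilbert_dist D p q + hilbert_dist D q y.
Proof.
move=> bD cvD oD Dp Dq Dy; rewrite -ler_expR expRD !expR_hilbert_dist//.
rewrite mulrACA [funk_dist D q p * _]mulrC.
by apply: ler_pM; rewrite ?funk_dist_triangle// ltW// funk_dist_gt0.
Qed.

Lemma hilbert_dist_sym D p q : bounded_set D -> convex_subset D -> open D ->
  D p -> D q -> hilbert_dist D p q = hilbert_dist D q p.
Proof. by move=> bD cvD oD Dp Dq; rewrite !hilbert_distE// mulrC. Qed.

(** Both Funk ratios are at most 1 + e <= exp e, because the ball of radius [r / 2] about [y] still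
    lies in [D]. *)
Lemma hilbert_dist_near D p y (e r : R) : bounded_set D -> convex_subset D ->
  open D -> D p -> D y -> (forall v : V, `|v| < r -> D (p + v)) -> 0 < e ->
  e < 1 -> `|y - p| < e * (r / 2) -> hilbert_dist D p y <= 2 * e.
Proof.
move=> bD cvD oD Dp Dy rD e0 e1 yp.
have r0 : 0 < r by have := le_lt_trans (normr_ge0 _) yp; rewrite pmulr_rgt0//; lra.
have rD' v : `|v| < r / 2 -> D (y + v).
  move=> vr; rewrite -[y](subrK p) [_ + p]addrC -addrA; apply: rD.
  by apply: le_lt_trans (ler_normD _ _) _; nra.
have e10 : 0 < 1 + e by rewrite addr_gt0.
have h1 : funk_dist D p y <= 1 + e.
  apply: funk_dist_le; apply: (funk_bound_near cvD oD Dy rD'); first by lra.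
  by rewrite addrAC subrr add0r.
have h2 : funk_dist D y p <= 1 + e.
  apply: funk_dist_le; apply: (funk_bound_near cvD oD Dp rD); first by lra.
  by rewrite addrAC subrr add0r distrC; nra.
rewrite -ler_expR expR_hilbert_dist// mulr_natl mulr2n expRD.
have h3 := expR_ge1Dx e.
by apply: ler_pM; rewrite ?(ltW (funk_dist_gt0 _ _ _ _))//; lra.
Qed.

Lemma hilbert_dist_cvg D (x : nat -> V) (F : set_system nat)
    (FF : ProperFilter F) xi q :
  bounded_set D -> convex_subset D -> open D -> (forall n, D (x n)) ->
  x @ F --> xi -> D xi -> D q ->
  (fun n => hilbert_dist D q (x n)) @ F --> hilbert_dist D q xi.
Proof.
move=> bD cvD oD Dx xxi Dxi Dq.
have [r r0 rD] := open_translate oD Dxi.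
apply/cvgrPdist_le => e e0.
pose d := e / (2 * (e + 1)).
have d0 : 0 < d by rewrite divr_gt0// mulr_gt0// addr_gt0.
have dE : d * (2 * (e + 1)) = e by rewrite divfK// gt_eqF// mulr_gt0// addr_gt0.
clearbody d; near=> n.
have h : hilbert_dist D xi (x n) <= 2 * d.
  apply: (hilbert_dist_near bD cvD oD Dxi (Dx n) rD d0); first by nra.
  by near: n; apply: near_norm_lt => //; rewrite mulr_gt0// divr_gt0.
have h1 := hilbert_dist_triangle bD cvD oD Dq Dxi (Dx n).
have h2 := hilbert_dist_triangle bD cvD oD Dq (Dx n) Dxi.
rewrite (hilbert_dist_sym bD cvD oD (Dx n) Dxi) in h2.
by rewrite ler_norml; apply/andP; split; nra.
Unshelve. all: by end_near. Qed.

(** * Separating two boundary points *)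

Lemma closure_combination D c c' z (r s t : R) : convex_subset D -> open D ->
  closure D c -> closure D c' -> D z -> 0 <= r -> 0 <= s -> 0 < t ->
  r + s + t = 1 -> D (r *: c + s *: c' + t *: z).
Proof.
move=> cvD oD clc clc' Dz r0 s0 t0 rst.
have [u Du uE] := cone_closure cvD oD clc' Dz s0 t0.
have [v Dv vE] := cone_closure cvD oD clc Du r0 (ltr_wpDl s0 t0).
by rewrite -addrA uE vE addrA rst scale1r.
Qed.

(** Apply [funk_dist_steeper] twice with [th = 1 / 2]: [p] is the midpoint of [xi] and [q] shifted
    along [b - xi], and symmetrically [q] is the midpoint of [eta] and [p] shifted along
    [b - eta]. *)
Lemma funk_dist_separation D xi eta b : bounded_set D -> convex_subset D -> open D ->
  eboundary D xi -> eboundary D eta -> D b -> xi != eta ->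
  exists p q, [/\ D p, D q, exists2 h, 0 <= h & q = p + h *: (eta - xi),
    funk_dist D xi p < funk_dist D xi q & funk_dist D eta q < funk_dist D eta p].
Proof.
move=> bD cvD oD [clxi nxi] [cleta neta] Db xieta.
(* At [s = 0] the vectors [q - xi] and [p - eta] are [e] and [- e]. *)
pose e : V := (2 / 3) *: (eta - xi).
have en0 : e != 0 by rewrite scaler_eq0 subr_eq0 [eta == _]eq_sym (negPf xieta) orbF gt_eqF//; lra.
have [s1 s10 s1E] := small_step bD clxi Db en0.
have [s2 s20 s2E] : exists2 s0 : R, 0 < s0 & forall (s l : R) z, 0 < s -> s < s0 -> 1 < l ->
    closure D z ->
    l *: (s *: (b - eta) + (1 - s) *: - e) = (l - 1) *: (z - eta) -> s * l < l - 1.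
  by apply: small_step; rewrite ?oppr_eq0.
have [s [s0 ss1 ss2 s1']] : exists s : R, [/\ 0 < s, s < s1, s < s2 & s < 1].
  exists (Num.min 1 (Num.min s1 s2) / 2).
  have : 0 < Num.min 1 (Num.min s1 s2) by rewrite !lt_min ltr01 s10.
  have : Num.min 1 (Num.min s1 s2) <= 1 by rewrite ge_min lexx.
  have : Num.min 1 (Num.min s1 s2) <= s1 by rewrite !ge_min lexx orbT.
  have : Num.min 1 (Num.min s1 s2) <= s2 by rewrite !ge_min lexx !orbT.
  by move=> h1 h2 h3 h4; split; lra.
(* The chord may lie in the boundary; the weight [s] on [b] brings its third points into [D]. *)
pose p := ((1 - s) * (2 / 3)) *: xi + ((1 - s) * (1 / 3)) *: eta + s *: b.
pose q := ((1 - s) * (1 / 3)) *: xi + ((1 - s) * (2 / 3)) *: eta + s *: b.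
have Dp : D p by apply: closure_combination => //; nra.
have Dq : D q by apply: closure_combination => //; nra.
have nD z w : ~ D z -> D w -> z != w by move=> nz Dw; apply/eqP => zw; apply: nz; rewrite zw.
exists p, q; split => //.
- exists ((1 - s) * (1 / 3)); first by rewrite mulr_ge0//; lra.
  by apply/rowP => i; rewrite !mxE; field.
- apply: (funk_dist_steeper (b := b) (th := 1 / 2) (s := s)) => //.
  + exact: nD.
  + lra.
  + have [z [clz _] zE] := funk_dist_exit bD cvD oD Dq (nD _ _ nxi Dq).
    apply: (s1E _ _ z) => //; first exact: funk_dist_gt1 (nD _ _ nxi Dq).
    have -> : s *: (b - xi) + (1 - s) *: e = q - xi.
      by apply/rowP => i; rewrite !mxE; field.
    rewrite scalerBr zE scalerBr; apply/rowP => i; rewrite !mxE; ring.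
  + by apply/rowP => i; rewrite !mxE; field.
- apply: (funk_dist_steeper (b := b) (th := 1 / 2) (s := s)) => //.
  + exact: nD.
  + lra.
  + have [z [clz _] zE] := funk_dist_exit bD cvD oD Dp (nD _ _ neta Dp).
    apply: (s2E _ _ z) => //; first exact: funk_dist_gt1 (nD _ _ neta Dp).
    have -> : s *: (b - eta) + (1 - s) *: - e = p - eta.
      by apply/rowP => i; rewrite !mxE; field.
    rewrite scalerBr zE scalerBr; apply/rowP => i; rewrite !mxE; ring.
  + by apply/rowP => i; rewrite !mxE; field.
Qed.

End Funk.

(** * From limit points to convergence *)

Theorem theorem1p3 (R : realType) (N : nat) (D : set 'rV[R]_N) (b : 'rV[R]_N)
  (x : nat -> 'rV[R]_N) (g : 'rV[R]_N -> R) :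
  bounded_set D -> convex_subset D -> open D -> D b ->
  (forall n, D (x n)) ->
  hconverges D b x g -> horofunction D b g ->
  exists2 xi : 'rV[R]_N, eboundary D xi & x @ \oo --> xi.
Proof.
move=> bD cvD oD Db Dx cvx [_ ng].
have cptD : compact (closure D).
  apply: bounded_closed_compact; last exact: closed_closure.
  have [C C0 CD] := closure_bounded bD.
  by exists C; split; [exact: gtr0_real|move=> M CM z /CD /le_trans; apply; exact: ltW].
(* Were the limit inside [D], continuity of the distance would give [g] the form excluded for
   horofunctions. *)
have limit_ex (F : set_system nat) : ProperFilter F -> F `=>` \oo ->
    exists G, [/\ ProperFilter G, G `=>` F & exists2 xi, eboundary D xi & x @ G --> xi].
  move=> PF Foo.
  have [G [PG FG [xi clxi xxi]]] :=
    compact_finer_cvg PF cptD (fun n => subset_closure (Dx n)).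
  exists G; split => //; exists xi => //; split => // Dxi; apply: ng.
  exists xi; split => // q Dq.
  have Goo : G `=>` \oo by apply: subset_trans FG.
  apply: (@cvg_unique _ (@Rhausdorff R) _ _ _ _ (cvg_trans (cvg_app _ Goo) (cvx _ Dq))).
  by apply: cvgB; apply: hilbert_dist_cvg.
have limit_eq (F G : set_system nat) xi eta : ProperFilter F -> ProperFilter G ->
    F `=>` \oo -> G `=>` \oo -> eboundary D xi -> eboundary D eta ->
    x @ F --> xi -> x @ G --> eta -> xi = eta.
  move=> PF PG Foo Goo bxi beta xxi xeta.
  apply/eqP/negPn/negP => xieta.
  have [p [q [Dp Dq [h h0 qE] Hxi Heta]]] :=
    funk_dist_separation bD cvD oD bxi beta Db xieta.
  (* The displacement read backwards allows the comparison at [eta]. *)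
  have pE : p = q + h *: (xi - eta).
    by rewrite qE; apply/rowP => i; rewrite !mxE; ring.
  have [[clxi nxi] [cleta neta]] := (bxi, beta).
  have pq := horofunction_lt PF bD cvD oD Db Dx cvx Foo xxi nxi cleta Dp Dq h0 qE Hxi.
  have qp := horofunction_lt PG bD cvD oD Db Dx cvx Goo xeta neta clxi Dq Dp h0 pE Heta.
  by have := lt_trans pq qp; rewrite ltxx.
have [F [PF Foo [xi bxi xxi]]] := limit_ex _ eventually_filter cvg_id.
exists xi => // A Axi; apply: contrapT => nA.
pose S := x @^-1` A.
(* If [x] avoids [A] infinitely often, the tail filter restricted to those indices is proper; its
   limit point is again [xi], so [x] would enter [A] there. *)
have PW : ProperFilter (within (~` S) \oo).
  split; last exact: within_filter.
  by rewrite /within /= => h; apply: nA; apply: filterS h => n; apply: contrapT.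
have [G [PG GW [eta beta xeta]]] := limit_ex _ PW (cvg_within _).
have GnS : G (~` S) by apply: GW; apply: withinT.
have := limit_eq F G xi eta PF PG Foo (cvg_trans GW (cvg_within _)) bxi beta xxi xeta.
move=> xieta; have GS : G S by apply: xeta; rewrite -xieta.
by have [n []] := filter_ex (filterI GS GnS).
Qed.
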